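(* Let $G$ be a group of rank $4$ and let $H\le G$ be a subgroup of finite index with $[G:H]\ge 4$. Suppose $S$ is a set of $4$ elements which generates $G$. Then there exists a sequence of Nielsen moves taking $S$ to a new set $\tilde S$ such that the elements of $\tilde S$ may be extended to a left-right transversal of $H$ in $G$ (that is, $\tilde S$ is contained in a left-right transversal of $H$ in $G$). Hence, given a finitely generated group $G$ of rank $4$ and a finite index subgroup $H$, there exists a left-right transversal of $H$ in $G$ which generates $G$ if and only if $\operatorname{rank}(G)\le [G:H]$.
   Context: The rank of a finitely generated group $G$, $\operatorname{rank}(G)$, is the smallest size of a generating set of $G$. A left (resp. right) transversal of $H$ in $G$ is a set containing exactly one element of each left coset $gH$ (resp. each right coset $Hg$). A left-right transversal is a set which is simultaneously a left and a right transversal. Given a finite multiset $S$ of elements of $G$, a Nielsen move on $S$ is either (1) replacing some entry $g$ of $S$ by $g^{-1}$, or (2) replacing some entry $g$ of $S$ by $hg$ or $gh$, where $h$ is another entry of $S$ (a different occurrence in the multiset). A Nielsen transformation is a finite sequence of Nielsen moves. *)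

(* Defs.v *)
From Stdlib Require Export Relation_Operators.
From mathcomp Require Export all_boot.
From mathcomp Require Export finmap multiset.
From mathcomp Require Export boolp classical_sets functions cardinality.

Set Implicit Arguments.
Unset Strict Implicit.
Unset Printing Implicit Defensive.

Local Open Scope mset_scope.
Local Open Scope classical_set_scope.
Local Open Scope group_scope.

Section Groups.
Variable G : groupType.
Implicit Types (S : {fset G}) (A H T : set G) (g h : G) (M N : {mset G}).

Definition subgroup H : Prop := group_closed [in H].

Definition lcoset H g : set G := [set g * h | h in H].
Definition rcoset H g : set G := [set h * g | h in H].

Definition lcosets H : set (set G) := range (lcoset H).

Definition finite_index H : Prop := finite_set (lcosets H).

(* Meaningful only under finite_index H: fset_set is empty on infinite sets. *)
Definition subgroup_index H : nat := #|` fset_set (lcosets H)|.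

Definition generated A : set G := smallest subgroup A.

Definition generates A : Prop := generated A = setT.

Definition left_transversal H T : Prop :=
  forall g, exists! t, (T `&` lcoset H g) t.

Definition right_transversal H T : Prop :=
  forall g, exists! t, (T `&` rcoset H g) t.

Definition left_right_transversal H T : Prop :=
  left_transversal H T /\ right_transversal H T.

(* In g +` (h +` M) the entries g and h are distinct occurrences, although
   they may be equal as elements of G. *)
Inductive nielsen_move : {mset G} -> {mset G} -> Prop :=
| NielsenInv g M :
    nielsen_move (g +` M) (g^-1 +` M)
| NielsenMulL g h M :
    nielsen_move (g +` (h +` M)) ((h * g) +` (h +` M))
| NielsenMulR g h M :
    nielsen_move (g +` (h +` M)) ((g * h) +` (h +` M)).

Definition nielsen_transformation : {mset G} -> {mset G} -> Prop :=
  clos_refl_trans {mset G} nielsen_move.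

(* The multiset in which each element of S occurs exactly once. *)
Definition mset_of_fset S : {mset G} := seq_mset (enum_fset S).

End Groups.

Definition generating_size (G : groupType) : set nat :=
  [set n | exists2 S : {fset G}, #|` S| = n & generates [set` S]].

Definition finitely_generated (G : groupType) : Prop :=
  exists S : {fset G}, generates [set` S].

(* Equal to 0 by convention when G is not finitely generated. *)
Definition group_rank (G : groupType) : nat :=
  xget 0%N [set n | generating_size G n /\
                    forall m, generating_size G m -> (n <= m)%N].

(* Main.v *)
(** Entries [g] of a generating tuple are recorded by the pair [(g H, H g)]; a
    finite set lies in a left-right transversal as soon as its elements have
    distinct left and distinct right cosets, because a double coset [H g H]
    contains as many left as right cosets (all of which meet), so that a free
    left coset leaves a free right coset.
    Nielsen moves bring the tuple to the form [r ++ t] with [r] in [H] and the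
    elements of [1 :: t] in distinct left and right cosets.  As long as [r] has
    two entries, one of them, [h1], can be replaced by a product [u * h1 * v],
    with [u] and [v] in the group [Q] generated by the other entries, which
    extends [t].  If every entry of [r] preserves the sets [(1 :: t) H] and
    [H (1 :: t)], then [Q] is not inside [(1 :: t) H], otherwise this set would
    be all of [G], and the counting above, applied in [Q], yields the new entry.
    If some [h2] in [r] takes some [x] in [t] outside, the new entry can be
    built from [h2 * x] and [h1], since at most one other element of [t] is in
    the way: this is where rank [4] is used. *)
From mathcomp Require Import all_fingroup zify.
Require Import Defs.

Set Implicit Arguments.
Unset Strict Implicit.
Unset Printing Implicit Defensive.

Local Open Scope mset_scope.
Local Open Scope classical_set_scope.
Local Open Scope group_scope.

(** * Membership in a subgroup, as rewriting rules *)

Section Subgroups.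
Variables (G : groupType) (H : set G).
Hypothesis sgH : subgroup H.
Implicit Types (g u v x y z : G).

Lemma subg1 : H 1.
Proof. by case: sgH => /set_mem. Qed.

Lemma subgV x : H x^-1 = H x.
Proof.
have Vl y : H y -> H y^-1.
  by move=> Hy; apply/set_mem/(group_closedV sgH)/mem_set.
by apply/propext; split=> /Vl; rewrite ?invgK.
Qed.

Lemma subgM x y : H x -> H y -> H (x * y).
Proof.
move=> Hx Hy; apply/set_mem.
by apply: (group_closedM sgH); apply/mem_set.
Qed.

Lemma subgMr v x : H v -> H (x * v) = H x.
Proof.
move=> Hv; apply/propext; split=> [Hxv|Hx]; last exact: subgM.
by rewrite -[x](mulgK v); apply: subgM => //; rewrite subgV.
Qed.

Lemma subgMl u x : H u -> H (u * x) = H x.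
Proof. by move=> Hu; rewrite -subgV invgM subgMr ?subgV. Qed.

End Subgroups.

(* If [g * v] were in [K * t] for all [v], the double coset [K g K] would be the
   union of the at most [#|s|] right cosets meeting [s = t :&: K g K], whereas the
   [#|s|] left cosets [x K], with [x] in [s], miss [g]. *)
Lemma finite_exchange (gT : finGroupType) (K : {group gT}) (t : {set gT}) g :
    {in t &, forall x y, x^-1 * y \in K -> x = y} ->
    (forall x, x \in t -> x^-1 * g \notin K) ->
  exists2 v, v \in K & forall x, x \in t -> (g * v) * x^-1 \notin K.
Proof.
move=> t_inj t_g; apply: contrapT => no_v.
pose D := K :* g * K; pose s := t :&: D.
pose KX (f : gT * gT -> gT) := [set f p | p in finset.setX s K]%SET.
have card_le f : #|KX f| <= #|s| * #|K|.
  by rewrite (leq_trans (leq_imset_card _ _)) // cardsX.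
have DE : D \subset KX (fun p => p.2 * p.1).
  apply/fintype.subsetP => _ /mulsgP[_ v /rcosetP[k Kk ->] Kv ->].
  have [x tx Kx] : exists2 x, x \in t & (g * v) * x^-1 \in K.
    apply: contrapT => no_x; apply: no_v; exists v => // x tx.
    by apply/negP => Kx; apply: no_x; exists x.
  apply/imsetP; exists (x, k * (g * v * x^-1)) => /=; last first.
    by rewrite -!mulgA mulVg mulg1.
  rewrite finset.in_setX groupM // andbT inE tx /=.
  (* As [x = (g * v * x^-1)^-1 * g * v], the element [x] is itself in [D], hence in [s]. *)
  apply/mulsgP; exists ((g * v * x^-1)^-1 * g) v => //.
    by rewrite mem_rcoset mulgK groupV.
  by rewrite -mulgA invgM invgK mulgKV.
have sub_D : KX (fun p => p.1 * p.2) \subset D :\ g.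
  apply/fintype.subsetP => _ /imsetP[[x k]
    /finset.setXP[/finset.setIP[tx Dx] Kk] ->] /=.
  rewrite !inE; apply/andP; split.
    by apply: contraNneq (t_g x tx) => <-; rewrite mulKg.
  have /mulsgP[y v Ky Kv ->] := Dx.
  by rewrite -mulgA mem_mulg // groupM.
have card_eq : #|KX (fun p => p.1 * p.2)| = (#|s| * #|K|)%N.
  rewrite card_in_imset ?finset.cardsX // => -[x k] [y l].
  case/finset.setXP=> /finset.setIP[tx _] Kk.
  case/finset.setXP=> /finset.setIP[ty _] Kl /= eq_xy.
  have xy : x = y.
    by apply: t_inj => //; rewrite -(mulgK l y) -eq_xy !mulgA mulVg mul1g
      groupM ?groupV.
  by move: eq_xy; rewrite xy => /mulgI->.
have Dg : g \in D by rewrite -[g]mulg1 mem_mulg ?rcoset_refl.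
have := leq_trans (subset_leq_card DE) (card_le _).
by rewrite -card_eq leqNgt (cardsD1 g D) Dg ltnS subset_leq_card.
Qed.

(** * Cosets, and the exchange argument in an infinite group *)

Section Cosets.
Variables (G : groupType) (H : set G).
Hypothesis sgH : subgroup H.
Implicit Types (g u v x y z : G) (Q : set G) (t : seq G).

Lemma lcosetE x y : lcoset H x y = H (x^-1 * y).
Proof.
apply/propext; split=> [[h Hh <-]|Hxy]; first by rewrite mulKg.
by exists (x^-1 * y); rewrite ?mulVKg.
Qed.

Lemma rcosetE x y : rcoset H x y = H (y * x^-1).
Proof.
apply/propext; split=> [[h Hh <-]|Hxy]; first by rewrite mulgK.
by exists (y * x^-1); rewrite ?mulgVK.
Qed.

Lemma lcoset_eq x y : (lcoset H x = lcoset H y) = H (x^-1 * y).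
Proof.
apply/propext; split=> [eq_xy|Hxy].
  by rewrite -lcosetE eq_xy lcosetE mulVg; apply: subg1.
apply/seteqP; split=> z; rewrite !lcosetE => Hz.
  have Hyx : H (y^-1 * x) by rewrite -subgV // invgM invgK.
  by move: (subgM sgH Hyx Hz); rewrite -mulgA mulVKg.
by move: (subgM sgH Hxy Hz); rewrite -mulgA mulVKg.
Qed.

Hypothesis fiH : finite_index H.

Let X := fset_set (lcosets H).

(* Translation by [g^-1] rather than [g]: products of permutations compose from
   left to right. *)
Let translate g (c : set G) : set G := [set g^-1 * u | u in c].

Let translate_lcoset g x : translate g (lcoset H x) = lcoset H (g^-1 * x).
Proof.
apply/seteqP; split=> z; rewrite lcosetE.
  by case=> u; rewrite lcosetE => Hu <-; rewrite invgM invgK -mulgA mulVKg.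
rewrite invgM invgK -mulgA => Hz; exists (g * z); last by rewrite mulKg.
by rewrite lcosetE.
Qed.

(** The default [c] of [insubd] is never returned, because a translate of a left coset is again a
    left coset ([val_act]). *)
Let act g (c : X) : X := insubd c (translate g (val c)).

Let val_act g c : val (act g c) = translate g (val c).
Proof.
rewrite insubdK //; have := valP c; rewrite !in_fset_set // !inE => -[x _ <-].
by rewrite translate_lcoset; exists (g^-1 * x).
Qed.

Let actM g h c : act (g * h) c = act h (act g c).
Proof.
apply: val_inj; rewrite !val_act; have := valP c.
rewrite in_fset_set // inE => -[x _ <-].
by rewrite !translate_lcoset invgM mulgA.
Qed.

Let act_inj g : injective (act g).
Proof.
apply: (can_inj (g := act g^-1)) => c; rewrite -actM mulgV.
apply: val_inj; rewrite val_act; have := valP c.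
by rewrite in_fset_set // inE => -[x _ <-]; rewrite translate_lcoset invg1 mul1g.
Qed.

Let coset_perm g : {perm X} := perm (@act_inj g).

Let coset_permM g h : coset_perm (g * h) = coset_perm g * coset_perm h.
Proof. by apply/perm.permP => c; rewrite permM !permE actM. Qed.

(** The stabilizer of the coset [H] is [H] itself. So, even if the action is not faithful, the
    permutation of an element decides whether it lies in [H]. *)
Let coset_perm_in g h : H h -> coset_perm g = coset_perm h -> H g.
Proof.
move=> Hh /perm.permP eq_gh.
have Xo : lcoset H 1 \in X by rewrite in_fset_set // inE; exists 1.
have := congr1 val (eq_gh [` Xo]%fset).
rewrite !permE !val_act /= !translate_lcoset !mulg1 lcoset_eq invgK.
by rewrite subgMr ?subgV.
Qed.

(** Reduces to [finite_exchange] in the permutations of the finitely many left cosets, with [K] the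
    image of the intersection of [Q] and [H]. By [coset_perm_in], an element of [Q] lies in [H]
    exactly when its permutation lies in [K]. *)
Lemma exchange Q t g :
    subgroup Q -> {in t, forall x, Q x} ->
    {in t &, forall x y, H (x^-1 * y) -> x = y} ->
    Q g -> {in t, forall x, ~ H (x^-1 * g)} ->
  exists v, [/\ Q v, H v & {in t, forall x, ~ H (g * v * x^-1)}].
Proof.
move=> sgQ Qt t_inj Qg t_g.
pose K : {set {perm X}} :=
  [set p | `[< exists q, [/\ Q q, H q & p = coset_perm q] >]]%SET.
have KP p : reflect (exists q, [/\ Q q, H q & p = coset_perm q]) (p \in K).
  by rewrite inE; apply: asboolP.
have phi1 : coset_perm 1 = 1.
  by apply: (@mulgI _ (coset_perm 1)); rewrite -coset_permM !mulg1.
have phiV x : coset_perm x^-1 = (coset_perm x)^-1.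
  by apply: (@mulgI _ (coset_perm x)); rewrite -coset_permM !mulgV.
have gK : group_set K.
  apply/group_setP; split; first by apply/KP; exists 1; split=> //; apply: subg1.
  move=> _ _ /KP[q [Qq Hq ->]] /KP[r [Qr Hr ->]]; apply/KP; exists (q * r).
  by split; rewrite ?coset_permM //; apply: subgM.
pose s : {set {perm X}} := [set p in map coset_perm t]%SET.
have sP p : p \in s -> exists2 x, x \in t & p = coset_perm x.
  by rewrite inE => /mapP.
have [||v /KP[w [Qw Hw ->]] s_v] :=
  @finite_exchange _ (group gK) s (coset_perm g).
- move=> _ _ /sP[x tx ->] /sP[y ty ->].
  rewrite -phiV -coset_permM => /KP[q [_ Hq eq_q]].
  by congr (coset_perm _); apply: t_inj => //; apply: coset_perm_in eq_q.
- move=> _ /sP[x tx ->]; rewrite -phiV -coset_permM; apply/KP => -[q [_ Hq eq_q]].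
  by case: (t_g x tx); apply: coset_perm_in eq_q.
exists w; split=> // x tx Hx; have := s_v (coset_perm x).
rewrite inE map_f // -phiV -!coset_permM => /(_ isT)/KP; apply.
exists (g * w * x^-1); split=> //.
by apply: subgM; rewrite ?subgV //; [apply: subgM|apply: Qt].
Qed.
End Cosets.

(** * Finding a new entry in a free left and a free right coset *)

Section Insertion.
Variables (G : groupType) (H : set G).
Hypotheses (sgH : subgroup H) (fiH : finite_index H).
Implicit Types (g h u v x y z : G) (Q : set G) (t : seq G).

Definition left_covered t g := exists2 z, z \in t & H (z^-1 * g).
Definition right_covered t g := exists2 z, z \in t & H (g * z^-1).

Definition left_independent t := {in t &, forall x y, H (x^-1 * y) -> x = y}.
Definition right_independent t := {in t &, forall x y, H (x * y^-1) -> x = y}.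

(** Inversion swaps left and right cosets; this and the next two lemmas let one-sided results be
    applied on the other side. *)
Lemma left_coveredV t g : left_covered [seq z^-1 | z <- t] g = right_covered t g^-1.
Proof.
apply/propext; split=> [[_ /mapP[z tz ->]]|[z tz]]; rewrite -(subgV sgH).
  by rewrite invgM !invgK => Hz; exists z.
by rewrite invgM !invgK => Hz; exists z^-1; rewrite ?invgK ?map_f.
Qed.

Lemma right_coveredV t g : right_covered [seq z^-1 | z <- t] g = left_covered t g^-1.
Proof.
apply/propext; split=> [[_ /mapP[z tz ->]]|[z tz]]; rewrite -(subgV sgH).
  by rewrite invgM => Hz; exists z; rewrite // -[z]invgK.
by rewrite invgM !invgK => Hz; exists z^-1; rewrite ?invgK ?map_f.
Qed.

Lemma left_independentV t : right_independent t -> left_independent [seq z^-1 | z <- t].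
Proof.
move=> t_inj _ _ /mapP[x tx ->] /mapP[y ty ->]; rewrite invgK => Hxy.
by rewrite (t_inj x y).
Qed.

(* With [v] in [Q] and [H] such that [h2 * x * v] is not in [H t], one of
   [h2 x h1], [h2 x h1 v], [h2 x v h1] and [h2 x v h1 v] is suitable; all of them
   are in the left coset of [h2 x]. *)
Lemma insert_moved Q t x y h1 h2 :
    subgroup Q -> {in t, forall z, Q z} -> left_independent t ->
    1 \in t -> x \in t -> {in t, forall z, [\/ z = 1, z = x | z = y]} ->
    H h1 -> H h2 -> Q h2 -> ~ left_covered t (h2 * x) ->
  exists u v, [/\ Q u, Q v, ~ left_covered t (u * h1 * v)
                & ~ right_covered t (u * h1 * v)].
Proof.
move=> sgQ Qt t_inj t1 tx tE Hh1 Hh2 Qh2 h2x.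
have nHx : ~ H x.
  by move=> Hx; apply: h2x; exists 1; rewrite // invg1 mul1g (subgMl sgH).
have [v [Qv Hv h2xv]] :
    exists v, [/\ Q v, H v & {in t, forall z, ~ H (h2 * x * v * z^-1)}].
  apply: (exchange sgH fiH sgQ Qt t_inj); first by apply: subgM => //; apply: Qt.
  by move=> z tz Hz; apply: h2x; exists z.
have xv z : z \in t -> ~ H (x * v * z^-1).
  by move=> tz Hz; apply: (h2xv z tz); rewrite -!mulgA (subgMl sgH) // mulgA.
have left_ok w : H w -> ~ left_covered t (h2 * x * w).
  by move=> Hw [z tz]; rewrite mulgA (subgMr sgH) // => Hz; apply: h2x; exists z.
have Qh2x : Q (h2 * x) by apply: subgM => //; apply: Qt.
(* Here [h2 * x * w * v] lies in the right coset of [x * v], which [t] misses. *)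
have right_v w : H (x * w * x^-1) -> ~ right_covered t (h2 * x * w * v).
  move=> Hw [z tz]; rewrite -!mulgA (subgMl sgH) //.
  have -> : x * (w * (v * z^-1)) = (x * w * x^-1) * (x * v * z^-1).
    by rewrite -!mulgA mulKg.
  by rewrite (subgMl sgH) //; apply: xv.
have [Hx1|nHx1] := pselect (H (x * h1 * x^-1)).
  exists (h2 * x), v; split=> //; last exact: right_v.
  by rewrite -mulgA; apply: left_ok; apply: subgM.
have [Hxv1|nHxv1] := pselect (H (x * (v * h1) * x^-1)).
  exists (h2 * x * v), v; split=> //; first exact: subgM.
    by rewrite -[_ * v * h1]mulgA -mulgA; apply: left_ok; do !apply: subgM => //.
  by rewrite -[_ * v * h1]mulgA; apply: right_v.
(* The right coset of [1] is excluded because [x] is not in [H], that of [x] by assumption; only [y]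
   can be in the way. *)
have right_y w : H w -> ~ H (x * w * x^-1) ->
    right_covered t (h2 * x * w) -> H (x * w * y^-1).
  move=> Hw nHw [z tz]; rewrite -!mulgA (subgMl sgH) //.
  by case: (tE z tz) => ->; rewrite ?mulgA // invg1 mulg1 subgMr.
have [cov1|] := pselect (right_covered t (h2 * x * h1)); last first.
  by exists (h2 * x), 1; rewrite mulg1; split=> //; [apply: subg1|apply: left_ok].
exists (h2 * x * v), 1; rewrite mulg1 -[_ * v * h1]mulgA; split.
- exact: subgM.
- exact: subg1.
- by apply: left_ok; apply: subgM.
have Hv1 : H (v * h1) by apply: subgM.
(* If [x * h1] and [x * v * h1] were both in [H y], then [x * v * x^-1] would be in [H], against the
   choice of [v]. *)
move=> /(right_y _ Hv1 nHxv1) Hyv1; apply: (xv x tx).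
have Hy1 := right_y _ Hh1 nHx1 cov1.
rewrite -(subgMr sgH _ Hy1).
by rewrite -!mulgA mulKg; move: Hyv1; rewrite -!mulgA.
Qed.

(** Exchange moves [g] within its left coset to some [g * v] outside [H t]. Since [H t h1^-1] is
    inside [H t], the product [g * v * h1] is outside [H t] too, and it is still in [g H]. *)
Lemma insert_stable Q t h1 g :
    subgroup Q -> {in t, forall z, Q z} -> left_independent t ->
    H h1 -> {in t, forall z, right_covered t (z * h1^-1)} ->
    Q g -> ~ left_covered t g ->
  exists u v, [/\ Q u, Q v, ~ left_covered t (u * h1 * v)
                & ~ right_covered t (u * h1 * v)].
Proof.
move=> sgQ Qt t_inj Hh1 t_h1 Qg t_g.
have [|v [Qv Hv gv]] := exchange sgH fiH sgQ Qt t_inj Qg.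
  by move=> z tz Hz; apply: t_g; exists z.
exists (g * v), 1; rewrite mulg1; split; [exact: subgM|exact: subg1| |].
  case=> z tz Hz; apply: t_g; exists z => //.
  by move: Hz; rewrite !mulgA 2?(subgMr sgH).
move=> [z tz Hz]; have [w tw Hw] := t_h1 z tz; apply: (gv w tw).
by move: (subgM sgH Hz Hw); rewrite !mulgA mulgVK mulgK.
Qed.
End Insertion.

(** * Nielsen transformations of sequences, taken up to permutation *)

Section Nielsen.
Variable G : groupType.
Implicit Types (g h u v x : G) (s r t : seq G) (A : set G) (M N : {mset G}).

Lemma subgroup_generated A : subgroup (generated A).
Proof.
split; first by apply/mem_set => K [[/set_mem K1 _] _].
move=> x y /set_mem Ax /set_mem Ay; apply/mem_set => K KA.
have [[_ KV] _] := KA; apply/set_mem; apply: KV; apply/mem_set.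
  exact: Ax.
exact: Ay.
Qed.

Lemma mem_generated A x : A x -> generated A x.
Proof. by move=> Ax K [_]; apply. Qed.

Lemma generated_sub A (K : set G) :
  subgroup K -> A `<=` K -> generated A `<=` K.
Proof. by move=> sgK AK x; apply. Qed.

Lemma subgroupP (K : set G) :
  K 1 -> (forall x y, K x -> K y -> K (x * y^-1)) -> subgroup K.
Proof.
move=> K1 KD; split; first exact/mem_set.
by move=> x y /set_mem Kx /set_mem Ky; apply/mem_set/KD.
Qed.

Definition nielsen s t := nielsen_transformation (seq_mset s) (seq_mset t).

Lemma nielsen_perm s t : perm_eq s t -> nielsen s t.
Proof. by move=> /eq_seq_msetP st; rewrite /nielsen st; apply: rt_refl. Qed.

Lemma nielsen_trans t s r : nielsen s t -> nielsen t r -> nielsen s r.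
Proof. exact: rt_trans. Qed.

Lemma nielsen_transformation_add x M N :
  nielsen_transformation M N ->
  nielsen_transformation (x +` M)%mset (x +` N)%mset.
Proof.
elim=> [{}M {}N MN|{}M|{}M {}N P _ MN _ NP]; [|exact: rt_refl|exact: rt_trans NP].
apply: rt_step; case: MN => [g L|g h L|g h L].
- by rewrite !(msetDCA [mset x]%mset); apply: NielsenInv.
- by rewrite !(msetDCA [mset x]%mset); apply: NielsenMulL.
- by rewrite !(msetDCA [mset x]%mset); apply: NielsenMulR.
Qed.

Lemma nielsen_cons x s t : nielsen s t -> nielsen (x :: s) (x :: t).
Proof. by rewrite /nielsen !mset_cons; apply: nielsen_transformation_add. Qed.

Lemma nielsenV g s : nielsen (g :: s) (g^-1 :: s).
Proof. by rewrite /nielsen !mset_cons; apply/rt_step/NielsenInv. Qed.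

Lemma nielsen_head_perm s t x y :
  perm_eq s t -> nielsen (x :: s) (y :: s) -> nielsen (x :: t) (y :: t).
Proof. by rewrite /nielsen !mset_cons => /eq_seq_msetP->. Qed.

Lemma nielsenMl h g s : h \in s -> nielsen (g :: s) (h * g :: s).
Proof.
move=> hs; apply: (@nielsen_head_perm (h :: rem h s)).
  by rewrite perm_sym perm_to_rem.
by rewrite /nielsen !mset_cons; apply/rt_step/NielsenMulL.
Qed.

(** Invert the entry [h], multiply by it, and invert it back. *)
Lemma nielsenMVl h g s : h \in s -> nielsen (g :: s) (h^-1 * g :: s).
Proof.
move=> hs; apply: (@nielsen_head_perm (h :: rem h s)).
  by rewrite perm_sym perm_to_rem.
have flip x y : nielsen [:: x, y & rem h s] [:: x, y^-1 & rem h s].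
  exact/nielsen_cons/nielsenV.
apply: nielsen_trans (flip _ _) _.
apply: nielsen_trans (nielsenMl _ (mem_head _ _)) _.
by apply: nielsen_trans (flip _ _) _; rewrite invgK; apply: nielsen_perm.
Qed.

(** The multipliers [u] that work, together with their inverses, for every head [g] form a subgroup
    [K] containing [s]; quantifying over [g] lets the transformations be composed. *)
Lemma nielsen_generated_l u g s :
  generated [set` s] u -> nielsen (g :: s) (u * g :: s).
Proof.
move=> su; pose K : set G := [set u | forall g, nielsen (g :: s) (u * g :: s) /\
  nielsen (g :: s) (u^-1 * g :: s)].
suff [sgK sK] : subgroup K /\ [set` s] `<=` K.
  by case: (generated_sub sgK sK su g).
split=> [|x /= sx {}g]; last by split; [apply: nielsenMl|apply: nielsenMVl].
apply: subgroupP => [{}g|x y Kx Ky {}g].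
  by rewrite invg1 mul1g; split; apply: nielsen_perm.
rewrite invgM invgK -!mulgA; split.
  exact: nielsen_trans (proj2 (Ky g)) (proj1 (Kx _)).
exact: nielsen_trans (proj2 (Kx g)) (proj1 (Ky _)).
Qed.

Lemma nielsen_generated_r v g s :
  generated [set` s] v -> nielsen (g :: s) (g * v :: s).
Proof.
move=> sv; apply: nielsen_trans (nielsenV _ _) _.
rewrite -[g * v]invgK invgM.
apply: nielsen_trans (nielsenV _ _); apply: nielsen_generated_l.
by rewrite subgV //; apply: subgroup_generated.
Qed.

Lemma nielsen_generated u v g s :
    generated [set` s] u -> generated [set` s] v ->
  nielsen (g :: s) (u * g * v :: s).
Proof.
move=> su sv; apply: nielsen_trans (nielsen_generated_l _ su) _.
exact: nielsen_generated_r.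
Qed.

(** After one move, each old entry is a product of new entries and their inverses. *)
Lemma nielsen_transformation_generated M N :
  nielsen_transformation M N -> generated [set` M] `<=` generated [set` N].
Proof.
elim=> [{}M {}N MN|{}M|{}M {}N P _ MN _ NP]; [|by []|exact: subset_trans NP].
apply: generated_sub; first exact: subgroup_generated.
have sg A := subgroup_generated A.
case: MN => [g L|g h L|g h L] x; rewrite /mkset !in_mset1D.
- case/orP=> [/eqP->|Lx]; last first.
    by apply: mem_generated; rewrite /mkset in_mset1D Lx orbT.
  by rewrite -subgV //; apply: mem_generated; rewrite /mkset !in_mset1D eqxx.
- case/orP=> [/eqP->|Lx]; last first.
    by apply: mem_generated; rewrite /mkset !in_mset1D Lx !orbT.
  rewrite -(subgMl (sg _) (u := h)); apply: mem_generated;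
    by rewrite /mkset !in_mset1D eqxx ?orbT.
- case/orP=> [/eqP->|Lx]; last first.
    by apply: mem_generated; rewrite /mkset !in_mset1D Lx !orbT.
  rewrite -(subgMr (sg _) (v := h)); apply: mem_generated;
    by rewrite /mkset !in_mset1D eqxx ?orbT.
Qed.

Lemma mset_set s : [set` seq_mset s] = [set` s].
Proof. by apply/seteqP; split=> x /=; rewrite (perm_mem (perm_eq_seq_mset s)). Qed.

Lemma nielsen_generates s t :
  nielsen s t -> generates [set` s] -> generates [set` t].
Proof.
move=> /nielsen_transformation_generated; rewrite !mset_set /generates => st s_gen.
by apply/seteqP; split=> // x _; apply: st; rewrite s_gen.
Qed.
End Nielsen.

(** * Reducing the number of entries in [H] *)

Section Reduction.
Variables (G : groupType) (H : set G).
Hypotheses (sgH : subgroup H) (fiH : finite_index H).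
Implicit Types (g h u v x y z : G) (s r t : seq G).

(** The two coset conditions compare elements, not positions, so [uniq] is what forbids repeated
    entries. *)
Definition independent t :=
  [/\ uniq t, left_independent H t & right_independent H t].

Lemma independent_cons g t :
  independent t -> ~ left_covered H t g -> ~ right_covered H t g ->
  independent (g :: t).
Proof.
move=> [t_uniq tl tr] gl gr; split.
- rewrite /= t_uniq andbT; apply/negP => tg; apply: gl; exists g => //.
  by rewrite mulVg; apply: subg1.
- move=> x y /[!inE] /predU1P[->|tx] /predU1P[->|ty] // Hxy; last exact: tl.
    by case: gl; exists y; rewrite // -subgV // invgM invgK.
  by case: gl; exists x.
- move=> x y /[!inE] /predU1P[->|tx] /predU1P[->|ty] // Hxy; last exact: tr.
    by case: gr; exists y.
  by case: gr; exists x; rewrite // -subgV // invgM invgK.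
Qed.

Lemma independent_swap x y t : independent (x :: y :: t) -> independent (y :: x :: t).
Proof.
move=> [xy_uniq tl tr]; have swap : {subset y :: x :: t <= x :: y :: t}.
  by move=> z; rewrite !inE orbCA.
split.
- by rewrite -(perm_uniq (permEl (perm_catCA [:: x] [:: y] t))).
- by move=> u v /swap tu /swap tv; apply: tl.
- by move=> u v /swap tu /swap tv; apply: tr.
Qed.

Lemma independent_behead x t : independent (x :: t) -> independent t.
Proof.
move=> [/andP[_ t_uniq] tl tr]; split=> // y z ty tz.
  by apply: tl; rewrite inE (ty, tz) orbT.
by apply: tr; rewrite inE (ty, tz) orbT.
Qed.

Lemma index_le_size t : (forall g, left_covered H t g) -> subgroup_index H <= size t.
Proof.
move=> t_cov; rewrite /subgroup_index -(size_map (lcoset H)).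
apply: uniq_leq_size => // c; rewrite in_fset_set // inE => -[g _ <-].
have [z tz Hz] := t_cov g; apply/mapP; exists z => //.
by apply/esym; rewrite lcoset_eq.
Qed.

Lemma nielsen_split s : exists r t,
  [/\ nielsen s (r ++ t), size (r ++ t) = size s, {in r, forall h, H h}
    & independent (1 :: t)].
Proof.
elim: s => [|x s [r [t [s_rt sz_rt Hr t_ind]]]].
  exists [::], [::]; split=> //; first exact: nielsen_perm.
  by split=> // x y /[!inE] /eqP-> /eqP->.
have in_H y : H y -> nielsen (x :: r ++ t) (y :: r ++ t) -> exists r t,
    [/\ nielsen (x :: s) (r ++ t), size (r ++ t) = (size s).+1,
        {in r, forall h, H h} & independent (1 :: t)].
  move=> Hy xy; exists (y :: r), t; split=> //=.
  - exact: nielsen_trans (nielsen_cons _ s_rt) xy.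
  - by rewrite sz_rt.
  - by move=> h /[!inE] /predU1P[->|/Hr].
have sg_rt := subgroup_generated [set` r ++ t].
have gen_t z : z \in 1 :: t -> generated [set` r ++ t] z^-1.
  rewrite inE => /predU1P[->|tz]; first by rewrite invg1; apply: subg1.
  by rewrite subgV //; apply: mem_generated; rewrite /= mem_cat tz orbT.
have [[z tz Hz]|nl] := pselect (left_covered H (1 :: t) x).
  by apply: in_H Hz _; apply: nielsen_generated_l; apply: gen_t.
have [[z tz Hz]|nr] := pselect (right_covered H (1 :: t) x).
  by apply: in_H Hz _; apply: nielsen_generated_r; apply: gen_t.
exists r, (x :: t); split=> //.
- apply: nielsen_trans (nielsen_cons _ s_rt) _; apply: nielsen_perm.
  by rewrite -cat1s -[x :: t]cat1s perm_catCA.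
- by rewrite [RHS]/= -sz_rt !size_cat addnS.
- exact/independent_swap/independent_cons.
Qed.

(* The case [h2 * x \notin (1 :: t) H]; the bound [size t <= 2] leaves at most
   one further element [y] in the way. *)
Lemma moved_pair Q t x h1 h2 :
    subgroup Q -> {in t, forall z, Q z} -> left_independent H (1 :: t) ->
    size t <= 2 -> x \in t -> H h1 -> H h2 -> Q h2 ->
    ~ left_covered H (1 :: t) (h2 * x) ->
  exists u v, [/\ Q u, Q v, ~ left_covered H (1 :: t) (u * h1 * v)
                & ~ right_covered H (1 :: t) (u * h1 * v)].
Proof.
move=> sgQ Qt t_ind sz_t tx Hh1 Hh2 Qh2 h2x.
have [y tE] : exists y, {in 1 :: t, forall z, [\/ z = 1, z = x | z = y]}.
  case: t tx sz_t {Qt t_ind h2x} => [//|a [|b [|//]]] /[!inE].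
    move=> /eqP-> _; exists 1 => z /[!inE] /orP[]/eqP->.
      exact: Or31.
    exact: Or32.
  case/orP=> /eqP-> _; [exists b|exists a] => z /[!inE] /or3P[]/eqP->;
    by [apply: Or31|apply: Or32|apply: Or33].
apply: (@insert_moved _ _ sgH fiH Q (1 :: t) x y h1 h2) => //.
- by move=> z /[!inE] /predU1P[->|/Qt //]; apply: subg1.
- by rewrite mem_head.
- by rewrite inE tx orbT.
Qed.

Lemma nielsen_step r t :
    {in r, forall h, H h} -> 1 < size r -> size t <= 2 ->
    independent (1 :: t) -> generates [set` r ++ t] -> 3 < subgroup_index H ->
  exists r' g, [/\ nielsen (r ++ t) (r' ++ g :: t), size r = (size r').+1,
                   {in r', forall h, H h} & independent (1 :: g :: t)].
Proof.
move=> Hr sz_r sz_t t_ind rt_gen idxH; have [t_uniq tl tr] := t_ind.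
have finish h1 r' : perm_eq r (h1 :: r') ->
    (exists u v, [/\ generated [set` r' ++ t] u, generated [set` r' ++ t] v,
       ~ left_covered H (1 :: t) (u * h1 * v)
     & ~ right_covered H (1 :: t) (u * h1 * v)]) ->
    exists r' g, [/\ nielsen (r ++ t) (r' ++ g :: t), size r = (size r').+1,
                     {in r', forall h, H h} & independent (1 :: g :: t)].
  move=> r_perm [u [v [Qu Qv gl gr]]]; exists r', (u * h1 * v); split.
  - apply: (@nielsen_trans _ (h1 :: r' ++ t)).
      by apply: nielsen_perm; rewrite -cat_cons perm_cat2r.
    apply: nielsen_trans (nielsen_generated h1 Qu Qv) _; apply: nielsen_perm.
    by rewrite -cat1s -[_ :: t]cat1s perm_catCA.
  - by rewrite (perm_size r_perm).
  - by move=> h r'h; apply: Hr; rewrite (perm_mem r_perm) inE r'h orbT.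
  - exact/independent_swap/independent_cons.
have sg_gen r' := subgroup_generated [set` r' ++ t].
have gen_t r' z : z \in t -> generated [set` r' ++ t] z.
  by move=> tz; apply: mem_generated; rewrite /= mem_cat tz orbT.
(* Since [r] has two entries, some other occurrence [h1] can be replaced while [h2] stays in the
   group generated by the remaining entries. *)
have pick2 h2 : h2 \in r \/ h2^-1 \in r -> H h2 /\ exists h1 r',
    [/\ perm_eq r (h1 :: r'), H h1 & generated [set` r' ++ t] h2].
  move=> rh2; have [k rk kE] : exists2 k, k \in r & h2 = k \/ h2 = k^-1.
    by case: rh2 => ?; [exists h2|exists h2^-1] => //; [left|right; rewrite invgK].
  have Hh2 : H h2 by case: kE => ->; rewrite ?subgV //; apply: Hr.
  split=> //; have := perm_to_rem rk; have := size_rem rk.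
  case: (rem k r) => [|h1 r']; first by case: (size r) sz_r => [|[|n]].
  move=> _ r_perm; exists h1, (k :: r'); split.
  - by apply: perm_trans r_perm _; rewrite -(cat1s k) -(cat1s h1) perm_catCA.
  - by apply: Hr; rewrite (perm_mem r_perm) !inE eqxx orbT.
  - have gk : generated [set` (k :: r') ++ t] k.
      by apply: mem_generated; rewrite /= inE eqxx.
    by case: kE => ->; rewrite ?subgV.
have [[h2 [x [/pick2[Hh2 [h1 [r' [r_perm Hh1 Qh2]]]] tx h2x]]]|no_l] := pselect
    (exists h x, [/\ h \in r \/ h^-1 \in r, x \in t
                   & ~ left_covered H (1 :: t) (h * x)]).
  apply: (finish _ _ r_perm).
  by apply: moved_pair h2x => //; move=> z; apply: gen_t.
have [[h2 [x [/pick2[Hh2 [h1 [r' [r_perm Hh1 Qh2]]]] tx h2x]]]|no_r] := pselect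
    (exists h x, [/\ h \in r \/ h^-1 \in r, x \in t
                   & ~ right_covered H (1 :: t) (x * h)]).
  apply: (finish _ _ r_perm).
  have mapE : 1 :: [seq z^-1 | z <- t] = [seq z^-1 | z <- 1 :: t].
    by rewrite /= invg1.
  (* The mirror image of the previous case, through inverses: the product found there is the inverse
     of [v^-1 * h1 * u^-1]. *)
  have [|||||||||u [v [Qu Qv]]] := @moved_pair (generated [set` r' ++ t])
      [seq z^-1 | z <- t] x^-1 h1^-1 h2^-1.
  - exact: sg_gen.
  - by move=> _ /mapP[z tz ->]; rewrite subgV //; apply: gen_t.
  - by rewrite mapE; apply: left_independentV.
  - by rewrite size_map.
  - exact: map_f.
  - by rewrite subgV.
  - by rewrite subgV.
  - by rewrite subgV.
  - by rewrite mapE left_coveredV // invgM !invgK.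
  rewrite mapE left_coveredV // right_coveredV // !invgM !invgK mulgA => gr gl.
  by exists v^-1, u^-1; split=> //; rewrite subgV.
have stable h x : h \in r \/ h^-1 \in r -> x \in 1 :: t ->
    left_covered H (1 :: t) (h * x) /\ right_covered H (1 :: t) (x * h).
  move=> rh; have [Hh _] := pick2 h rh; rewrite inE => /predU1P[->|tx].
    by split; exists 1; rewrite ?mem_head // ?invg1 !(mulg1, mul1g).
  split; apply: contrapT => hx; [apply: no_l|apply: no_r]; by exists h, x.
case: r sz_r Hr rt_gen stable finish {no_l no_r pick2} => [//|h1 r'] _ Hr rt_gen stable.
move=> finish; apply: (finish h1 r' (perm_refl _)) => {finish}.
pose Q := generated [set` r' ++ t].
have QT z : z \in 1 :: t -> Q z.
  by rewrite inE => /predU1P[->|/(gen_t r') //]; exact: subg1 (sg_gen r').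
have [[g Qg t_g]|cov] := pselect (exists2 g, Q g & ~ left_covered H (1 :: t) g).
  apply: (insert_stable sgH fiH _ _ tl _ _ Qg t_g) => //.
  - exact: sg_gen.
  - by apply: Hr; rewrite mem_head.
  - move=> z tz; have [|_ //] := stable h1^-1 z _ tz.
    by right; rewrite invgK mem_head.
have covQ g : Q g -> left_covered H (1 :: t) g.
  by move=> Qg; apply: contrapT => t_g; apply: cov; exists g.
(* Asking for both [g] and [g^-1] makes [K] a subgroup. It contains [h1] by [stable] and the other
   entries by [covQ], so it is all of [G]; then [1 :: t] meets every left coset and the index is at
   most 3. *)
pose K := [set g | {in 1 :: t, forall z, left_covered H (1 :: t) (g * z) /\
                                         left_covered H (1 :: t) (g^-1 * z)}].
have cov_mul g z : {in 1 :: t, forall z, left_covered H (1 :: t) (g * z)} ->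
    left_covered H (1 :: t) z -> left_covered H (1 :: t) (g * z).
  move=> Kg [w tw Hw]; have [w' tw' Hw'] := Kg w tw; exists w' => //.
  by move: (subgM sgH Hw' Hw); rewrite -!mulgA mulVKg.
suff KT g : K g.
  have : subgroup_index H <= size (1 :: t).
    by apply: index_le_size => x; rewrite -[x]mulg1; case: (KT x 1 (mem_head _ _)).
  by rewrite leqNgt (leq_trans _ idxH).
have : generated [set` (h1 :: r') ++ t] g by rewrite rt_gen.
apply: generated_sub g; last first.
  move=> g /=; rewrite inE => /predU1P[->|Qg] z tz.
    split; [case: (stable h1 z)|case: (stable h1^-1 z)] => //.
      by left; rewrite mem_head.
    by right; rewrite invgK mem_head.
  have {}Qg : Q g by apply: mem_generated.
  by split; apply: covQ; apply: (subgM (sg_gen _)); rewrite ?subgV //; apply: QT.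
apply: subgroupP => [z tz|x y Kx Ky z tz].
  by rewrite invg1 mul1g; split; apply: covQ; apply: QT.
rewrite invgM invgK -!mulgA; split.
  by apply: cov_mul; [move=> w /Kx[]|case: (Ky z tz)].
by apply: cov_mul; [move=> w /Ky[]|case: (Kx z tz)].
Qed.
End Reduction.

(** * Extension to a transversal, and comparison of rank and index *)

Section Transversals.
Variables (G : groupType) (H : set G).
Hypotheses (sgH : subgroup H) (fiH : finite_index H).
Implicit Types (g h u v x y z : G) (s r t : seq G).

Lemma size_le_index t : independent H t -> size t <= subgroup_index H.
Proof.
move=> [t_uniq tl _]; rewrite -(size_map (lcoset H)) /subgroup_index.
apply: uniq_leq_size.
  rewrite map_inj_in_uniq // => x y tx ty eq_xy; apply: tl => //.
  by rewrite -lcoset_eq.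
by move=> _ /mapP[x _ ->]; rewrite in_fset_set // inE; exists x.
Qed.

(** If [H g] missed [t], exchange applied to the inverses would give [v] in [H] with the left coset
    of [v^-1 * g] missing [t]. *)
Lemma left_covered_right t : left_independent H t -> right_independent H t ->
  (forall g, left_covered H t g) -> forall g, right_covered H t g.
Proof.
move=> tl tr cov g; apply: contrapT => t_g.
have sgT : subgroup [set: G] by apply: subgroupP.
have [||||v [_ Hv gv]] :=
  @exchange _ H sgH fiH setT [seq z^-1 | z <- t] g^-1 sgT => //.
- exact: left_independentV.
- move=> _ /mapP[z tz ->]; rewrite -subgV // invgM !invgK => Hz.
  by apply: t_g; exists z.
have [z tz Hz] := cov (v^-1 * g); apply: (gv z^-1 (map_f _ tz)).
by rewrite -subgV // !invgM !invgK.
Qed.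

(** Induction on the number of free left cosets. Exchange in the whole group moves [g], inside its
    free left coset, to a free right coset. *)
Lemma extend_transversal t : independent H t ->
  exists T, left_right_transversal H T /\ [set` t] `<=` T.
Proof.
have [n] := ubnP (subgroup_index H - size t); elim: n t => // n IHn t lt_n t_ind.
have [t_uniq tl tr] := t_ind.
have [cov|/existsNP[g t_g]] := pselect (forall g, left_covered H t g).
  exists [set` t]; split=> //.
  split=> g; [have [z tz Hz] := cov g|have [z tz Hz] := left_covered_right tl tr cov g].
    exists z; split=> [|y [ty]]; rewrite /= ?lcosetE.
      by split=> //; rewrite -subgV // invgM invgK.
    move=> Hy; apply: tl => //.
    by move: (subgM sgH Hz Hy); rewrite -!mulgA mulVKg.
  exists z; split=> [|y [ty]]; rewrite /= ?rcosetE.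
    by split=> //; rewrite -subgV // invgM invgK.
  move=> Hy; apply/esym/tr => //.
  by move: (subgM sgH Hy Hz); rewrite -!mulgA mulKg.
have sgT : subgroup [set: G] by apply: subgroupP.
have [||||v [_ Hv gv]] := @exchange _ H sgH fiH setT t g sgT => //.
  by move=> z tz Hz; apply: t_g; exists z.
have gv_ind : independent H (g * v :: t).
  apply: independent_cons => // -[z tz]; last by move/(gv z tz).
  by rewrite mulgA subgMr // => Hz; apply: t_g; exists z.
have [|T [T_lr tT]] := IHn _ _ gv_ind.
  by have := size_le_index gv_ind; rewrite /=; move: lt_n; lia.
exists T; split=> // x tx; apply: tT.
by rewrite /= inE; apply/orP; right.
Qed.

Lemma nielsen_independent s :
    size s = 4 -> generates [set` s] -> 3 < subgroup_index H ->
  exists t, nielsen s t /\ independent H t.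
Proof.
move=> sz_s s_gen idxH; have [r [t [s_rt sz_rt Hr t_ind]]] := nielsen_split sgH s.
have rt_gen := nielsen_generates s_rt s_gen; move: sz_rt; rewrite sz_s size_cat.
move=> sz_rt'; suff [t' [rt_t' t'_ind]] :
    exists t', nielsen (r ++ t) t' /\ independent H t'.
  by exists t'; split=> //; apply: nielsen_trans s_rt rt_t'.
move: sz_rt'; have [n] := ubnP (size r).
elim: n r t Hr t_ind rt_gen {s_rt} => // n IHn [|h1 [|h2 r]] t Hr t_ind rt_gen.
- by exists t; split; [apply: nielsen_perm|apply: independent_behead t_ind].
(* The last entry in [H] takes the place of [1] as representative of the coset [H]. *)
- exists (h1 :: t); split; first exact: nielsen_perm.
  have Hh1 : H h1 by apply: Hr; rewrite mem_head.
  have nHt z : z \in t -> ~ H z.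
    move=> tz Hz; have [/= /andP[/negP t1 _] tl _] := t_ind; apply: t1.
    by rewrite (tl 1 z) ?mem_head ?inE ?tz ?orbT // invg1 mul1g.
  apply: independent_cons (independent_behead t_ind) _ _ => // -[z /nHt nHz].
    by rewrite subgMr // subgV.
  by rewrite subgMl // subgV.
- move=> lt_n sz_rt.
  (* With four entries in all and at least two in [H], at most two are left for [t], as
     [nielsen_step] requires. *)
  have [//||r' [g [rt_r' sz_r' Hr' g_ind]]] :=
    nielsen_step sgH fiH Hr _ _ t_ind rt_gen idxH; first by move: sz_rt => /=; lia.
  have [||t' [? ?]] := IHn r' (g :: t) Hr' g_ind (nielsen_generates rt_r' rt_gen).
  + by move: lt_n; rewrite sz_r'.
  + by move: sz_rt; rewrite sz_r' /=; lia.
  by exists t'; split=> //; apply: nielsen_trans rt_r' _.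
Qed.

Lemma group_rank_le (S : {fset G}) : generates [set` S] -> group_rank G <= #|` S|.
Proof.
move=> S_gen; rewrite /group_rank; case: xgetP => // n _ [_ n_min].
by apply: n_min; exists S.
Qed.

Lemma group_rank_le_index T :
  left_right_transversal H T -> generates T -> group_rank G <= subgroup_index H.
Proof.
move=> [T_l _] T_gen.
(* The default [1] is never returned on a left coset, and the values of [rep] on the finitely many
   left cosets exhaust [T]. *)
pose rep (c : set G) := xget 1 (T `&` c).
pose S := [fset rep c | c in fset_set (lcosets H)]%fset.
apply: (leq_trans (group_rank_le (S := S) _)); last exact: leq_imfset_card.
rewrite /generates; apply/seteqP; split=> // x _.
have : generated T x by rewrite T_gen.
apply: generated_sub x; first exact: subgroup_generated.
move=> x Tx; apply: mem_generated; apply/imfsetP; exists (lcoset H x) => /=.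
  by rewrite in_fset_set // inE; exists x.
have Hx : (T `&` lcoset H x) x by split; rewrite // lcosetE mulVg; apply: subg1.
have [z [_ z_uniq]] := T_l x; apply/esym/xget_unique => // y Hy.
by rewrite -(z_uniq x) // -(z_uniq y).
Qed.
End Transversals.

Theorem theorem1p4 (G : groupType) (H : set G)
    (fgG : finitely_generated G) (rankG : group_rank G = 4)
    (sgH : subgroup H) (fiH : finite_index H) :
  (4 <= subgroup_index H ->
   forall S : {fset G}, #|` S| = 4 -> generates [set` S] ->
   exists S' : {fset G},
     nielsen_transformation (mset_of_fset S) (mset_of_fset S') /\
     exists T : set G, left_right_transversal H T /\ [set` S'] `<=` T)
  /\
  ((exists T : set G, left_right_transversal H T /\ generates T)
     <-> group_rank G <= subgroup_index H).
Proof.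
have part1 : 4 <= subgroup_index H ->
   forall S : {fset G}, #|` S| = 4 -> generates [set` S] ->
   exists S' : {fset G},
     nielsen_transformation (mset_of_fset S) (mset_of_fset S') /\
     exists T : set G, left_right_transversal H T /\ [set` S'] `<=` T.
  move=> idxH S S4 S_gen.
  have [t [St t_ind]] := nielsen_independent sgH fiH S4 S_gen idxH.
  have [T [T_lr tT]] := extend_transversal sgH fiH t_ind.
  exists (seq_fset tt t); split; last first.
    by exists T; split=> // x Sx; apply: tT; rewrite /= -(seq_fsetE tt).
  have [t_uniq _ _] := t_ind; rewrite /mset_of_fset.
  (* As [t] has no repeated entry, turning it into a finite set loses no multiplicity. *)
  suff -> : seq_mset (enum_fset (seq_fset tt t)) = seq_mset t by [].
  by apply/eq_seq_msetP; rewrite -[X in perm_eq _ X](undup_id t_uniq) seq_fset_perm.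
split=> //; split=> [[T [T_lr T_gen]]|]; first exact: group_rank_le_index T_lr T_gen.
rewrite rankG => idxH.
(* The rank is 4, not the default 0, so it is attained by a generating set. *)
have [S S4 S_gen] : generating_size G 4.
  by move: rankG; rewrite /group_rank; case: xgetP => // n -> [? _] <-.
have [S' [SS' [T [T_lr S'T]]]] := part1 idxH S S4 S_gen.
exists T; split=> //; apply/seteqP; split=> // x _.
have : generated [set` S'] x by rewrite (nielsen_generates SS' S_gen).
apply: generated_sub x; first exact: subgroup_generated.
by move=> x /S'T; apply: mem_generated.
Qed.
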